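(* Let $(u_{\boldsymbol j}^n,v_{\boldsymbol j}^n,p_{\boldsymbol j}^n)$ be a solution of the first-order fully discrete semi-implicit scheme with Dirichlet boundary conditions described in the context. Then for all $n\ge 0$, $$\|U^{n+1}\|_2^2-\|U^n\|_2^2\le h\sum_{{\boldsymbol j}\in\mathcal{B}_N}\left[\left(u_{\partial\Omega,{\boldsymbol j}}^{n+1}\right)^2-\left(u_{\partial\Omega,{\boldsymbol j}}^{n}\right)^2\right]+2d_1\frac{\tau}{h}\sum_{{\boldsymbol j}\in\mathcal{B}}\left(u_{\partial\Omega,{\boldsymbol j}}^{n+1}\right)^2$$ and $$\|V^{n+1}\|_2^2-\|V^n\|_2^2\le h\sum_{{\boldsymbol j}\in\mathcal{B}_N}\left[\left(v_{\partial\Omega,{\boldsymbol j}}^{n+1}\right)^2-\left(v_{\partial\Omega,{\boldsymbol j}}^{n}\right)^2\right]+2d_2\frac{\tau}{h}\sum_{{\boldsymbol j}\in\mathcal{B}}\left(v_{\partial\Omega,{\boldsymbol j}}^{n+1}\right)^2,$$ where $\mathcal{B}$ is the set of boundary multi-indices, $\mathcal{B}_N$ is the set of multi-indices with no component equal to $0$ and at least one component equal to $N$, and the norms and boundary values are as defined in the context.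
   Context: Let $\epsilon,\lambda,d_1,d_2>0$ be constants, $\Omega=[a,b]^d$ with $b>a$, $N$ a positive integer, $h=(b-a)/N$, time step $\tau>0$, $t_n=n\tau$. Grid nodes are $x_{\boldsymbol j}=(a+j_1h,\dots,a+j_dh)$ with multi-index ${\boldsymbol j}=(j_1,\dots,j_d)$, $j_i\in\{0,\dots,N\}$. A node is on the boundary ($x_{\boldsymbol j}\in\partial\Omega$, and ${\boldsymbol j}$ is then called a boundary multi-index) if $j_i\in\{0,N\}$ for some $i$, and interior otherwise. $\Delta_h$ is the second-order central difference Laplacian, $\Delta_h u_{\boldsymbol j}=h^{-2}\sum_{m=1}^d(u_{{\boldsymbol j}+{\boldsymbol e}_m}-2u_{\boldsymbol j}+u_{{\boldsymbol j}-{\boldsymbol e}_m})$, with ${\boldsymbol e}_m$ the $m$-th unit vector. The fully discrete scheme, for $n=0,1,2,\dots$, is $$\left[1+\tfrac{\tau}{\epsilon}(u_{\boldsymbol j}^n+v_{\boldsymbol j}^n)\right]p_{\boldsymbol j}^{n+1}=p_{\boldsymbol j}^n+\tfrac{\tau}{\epsilon}u_{\boldsymbol j}^n\quad\text{(all nodes } {\boldsymbol j}),$$ $$\left[1+\tfrac{\tau}{\epsilon}\left(v_{\boldsymbol j}^n+\lambda(1-p_{\boldsymbol j}^{n+1})\right)-d_1\tau\Delta_h\right]u_{\boldsymbol j}^{n+1}=u_{\boldsymbol j}^n\quad\text{(interior nodes)},$$ $$\left[1+\tfrac{\tau}{\epsilon}\left(u_{\boldsymbol j}^{n+1}+\lambda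 p_{\boldsymbol j}^{n+1}\right)-d_2\tau\Delta_h\right]v_{\boldsymbol j}^{n+1}=v_{\boldsymbol j}^n\quad\text{(interior nodes)},$$ with given initial values $u_{\boldsymbol j}^0,v_{\boldsymbol j}^0,p_{\boldsymbol j}^0$ at all nodes and Dirichlet conditions $u_{\boldsymbol j}^n=u_{\partial\Omega}(t_n)$, $v_{\boldsymbol j}^n=v_{\partial\Omega}(t_n)$ for $x_{\boldsymbol j}\in\partial\Omega$, $n\ge1$, where $u_{\partial\Omega},v_{\partial\Omega}$ are given functions of time. Notation: for a boundary node $x_{\boldsymbol j}$, $u_{\partial\Omega,{\boldsymbol j}}^n:=u_{\boldsymbol j}^n$ and $v_{\partial\Omega,{\boldsymbol j}}^n:=v_{\boldsymbol j}^n$ denote the boundary values at time $t_n$ (for $n\ge1$ these are the prescribed Dirichlet values). $U^n=(u_{\boldsymbol j}^n)$, $V^n=(v_{\boldsymbol j}^n)$, and $$\|U^n\|_2=\Big(\sum_{{\boldsymbol j}:\ j_i\ne0\ \forall i}h\,(u_{\boldsymbol j}^n)^2\Big)^{1/2},\qquad \|V^n\|_2=\Big(\sum_{{\boldsymbol j}:\ j_i\ne0\ \forall i}h\,(v_{\boldsymbol j}^n)^2\Big)^{1/2}.$$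
   Formalization: The formal theorem additionally assumes nonnegative data: u^0, v^0 ≥ 0 and 0 ≤ p^0 ≤ 1 at all nodes, and boundary values u_∂Ω(t_n), v_∂Ω(t_n) ≥ 0 for n ≥ 1; without sign conditions on the data the stated inequality can fail. *)

(* Defs.v *)
From HB Require Import structures.
From mathcomp Require Import all_boot all_order all_algebra.
From mathcomp Require Import reals.

Set Implicit Arguments.
Unset Strict Implicit.
Unset Printing Implicit Defensive.

Import Order.TTheory GRing.Theory Num.Theory.
Local Open Scope ring_scope.

(* Multi-indices j = (j_1, ..., j_d) with each j_i in {0, ..., N}. *)
Definition multi_index (d N : nat) := {ffun 'I_d -> 'I_N.+1}.

Definition boundary (d N : nat) (j : multi_index d N) : bool :=
  [exists i : 'I_d, (j i == ord0) || (j i == ord_max)].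

(* j + e_m and j - e_m.  When the m-th component would leave {0, ..., N} the
   value carries no meaning, but the scheme only uses these at interior
   nodes, where the shifted index always stays on the grid. *)
Definition shift_up (d N : nat) (m : 'I_d) (j : multi_index d N) :
    multi_index d N :=
  [ffun i => if i == m then inord (j i).+1 else j i].

Definition shift_down (d N : nat) (m : 'I_d) (j : multi_index d N) :
    multi_index d N :=
  [ffun i => if i == m then inord (j i).-1 else j i].

Definition mesh_size (R : realType) (a b : R) (N : nat) : R := (b - a) / N%:R.

Definition laplacian_h (R : realType) (d N : nat) (h : R)
    (w : multi_index d N -> R) (j : multi_index d N) : R :=
  h ^- 2 * \sum_(m < d) (w (shift_up m j) - 2 * w j + w (shift_down m j)).

(* [1 + c - kappa Delta_h] applied to the grid function w, at node j. *)
Definition implicit_op (R : realType) (d N : nat) (h c kappa : R)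
    (w : multi_index d N -> R) (j : multi_index d N) : R :=
  (1 + c) * w j - kappa * laplacian_h h w j.

(* The initial values are u 0, v 0, p 0, which are left unconstrained here; in
   particular the Dirichlet conditions are imposed only at t_n with n >= 1. *)
Record scheme_solution (R : realType) (d N : nat)
    (a b eps lambda d1 d2 tau : R) (u_bd v_bd : R -> R)
    (u v p : nat -> multi_index d N -> R) : Prop := SchemeSolution {
  scheme_p : forall (n : nat) (j : multi_index d N),
    (1 + tau / eps * (u n j + v n j)) * p n.+1 j = p n j + tau / eps * u n j;
  scheme_u : forall (n : nat) (j : multi_index d N), ~~ boundary j ->
    implicit_op (mesh_size a b N)
      (tau / eps * (v n j + lambda * (1 - p n.+1 j))) (d1 * tau) (u n.+1) j
    = u n j;
  scheme_v : forall (n : nat) (j : multi_index d N), ~~ boundary j ->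
    implicit_op (mesh_size a b N)
      (tau / eps * (u n.+1 j + lambda * p n.+1 j)) (d2 * tau) (v n.+1) j
    = v n j;
  dirichlet_u : forall (n : nat) (j : multi_index d N),
    (0 < n)%N -> boundary j -> u n j = u_bd (n%:R * tau);
  dirichlet_v : forall (n : nat) (j : multi_index d N),
    (0 < n)%N -> boundary j -> v n j = v_bd (n%:R * tau)
}.

(* The weight is h, not h ^+ d, in every dimension d. *)
Definition norm2_h (R : realType) (d N : nat) (h : R)
    (w : multi_index d N -> R) : R :=
  Num.sqrt (\sum_(j : multi_index d N | [forall i, j i != ord0]) h * w j ^+ 2).

Definition B_set (d N : nat) : {set multi_index d N} :=
  [set j : multi_index d N | boundary j].

Definition BN_set (d N : nat) : {set multi_index d N} :=
  [set j : multi_index d N |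
     [forall i, j i != ord0] && [exists i, j i == ord_max]].

(* Main.v *)
Require Import Defs.
From HB Require Import structures.
From mathcomp Require Import all_boot all_order all_algebra.
From mathcomp Require Import reals.
From mathcomp Require Import ring lra.

(** Write w for the new time level of u (or v), f for the old one, and Int for
    the interior nodes. At an interior node the scheme reads
    (1 + c) w - kappa Delta_h w = f, where kappa = d1 tau (or d2 tau) and c is
    the reaction coefficient. Since w^2 - f^2 = 2 w (w - f) - (w - f)^2, we get

      w^2 - f^2 <= 2 w (w - f) = 2 kappa w Delta_h w - 2 c w^2,

    so that, once c >= 0 is known, the growth of the interior energy is at most
    twice kappa times the sum over Int of w Delta_h w. The other nodes counted
    by the norm form B_N, and their contribution is the first term of the bound.

    The sum of w Delta_h w is controlled by the pointwise inequality

      2 w_j (w_(j+e) - 2 w_j + w_(j-e)) <= w_(j+e)^2 - 2 w_j^2 + w_(j-e)^2,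

    followed by a summation by parts for Q = w^2. A shift in direction m maps
    Int injectively into the union of Int and the relatively open faces of the
    grid orthogonal to direction m ([open_face]), so the interior terms cancel
    and only boundary values of Q remain ([sum_second_difference_le]). As the
    open faces for distinct directions are disjoint, every boundary node is
    charged for one direction only, which is why the bound does not grow with
    the dimension. This yields [implicit_step_energy].

    The sign of c is where the nonnegativity of the data enters: c is a
    nonnegative combination of v and 1 - p, or of u and p. The bounds u, v >= 0
    and 0 <= p <= 1 propagate in time ([scheme_bounds]), because the update of p
    is a weighted mean and because the implicit operator satisfies a discrete
    minimum principle ([implicit_op_min_principle]). *)

Set Implicit Arguments.
Unset Strict Implicit.
Unset Printing Implicit Defensive.

Import Order.TTheory GRing.Theory Num.Theory.
Local Open Scope ring_scope.

(** * Interior nodes, shifts and open faces *)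

Definition interior (d N : nat) : {set multi_index d N} := ~: B_set d N.

(** The relative interiors of the two faces orthogonal to direction m, taken
    together. Edges and corners are left out: no interior node has a neighbour
    there, and omitting them makes these sets disjoint for distinct m. *)
Definition open_face (d N : nat) (m : 'I_d) : {set multi_index d N} :=
  [set j : multi_index d N | ((j m == ord0) || (j m == ord_max)) &&
           [forall i, (i != m) ==> (0 < j i < N)%N]].

Lemma coord_interiorE (N : nat) (k : 'I_N.+1) :
  (0 < k < N)%N = ~~ ((k == ord0) || (k == ord_max)).
Proof.
have kN : (k <= N)%N by rewrite -ltnS ltn_ord.
by rewrite negb_or -!val_eqE /= lt0n ltn_neqAle kN andbT.
Qed.

Lemma not_boundaryP (d N : nat) (j : multi_index d N) :
  reflect (forall i, (0 < j i < N)%N) (~~ boundary j).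
Proof.
rewrite negb_exists.
by apply: (iffP forallP) => hj i; move/(_ i): hj; rewrite coord_interiorE.
Qed.

Lemma shift_up_inj (d N : nat) (m : 'I_d) :
  {in interior d N &, injective (shift_up m)}.
Proof.
move=> j k; rewrite !inE => /not_boundaryP hj /not_boundaryP hk /ffunP ejk.
apply/ffunP => i; move/(_ i): ejk; rewrite !ffunE.
case: ifP => // _ /(congr1 (@nat_of_ord _)).
have /andP[_ ji] := hj i; have /andP[_ ki] := hk i.
by rewrite !inordK // => -[] /val_inj.
Qed.

Lemma shift_down_inj (d N : nat) (m : 'I_d) :
  {in interior d N &, injective (shift_down m)}.
Proof.
move=> j k; rewrite !inE => /not_boundaryP hj /not_boundaryP hk /ffunP ejk.
apply/ffunP => i; move/(_ i): ejk; rewrite !ffunE.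
case: ifP => // _ /(congr1 (@nat_of_ord _)).
have /andP[ji _] := hj i; have /andP[ki _] := hk i.
rewrite !inordK ?(leq_ltn_trans (leq_pred _)) // => e.
by apply/val_inj; rewrite /= -(prednK ji) e (prednK ki).
Qed.

(** A shift in direction m changes only the m-th component, hence the images of
    interior nodes under it are of this kind. *)
Lemma off_boundary_or_open_face (d N : nat) (m : 'I_d) (k : multi_index d N) :
  (forall i, i != m -> (0 < k i < N)%N) ->
  k \in interior d N :|: open_face N m.
Proof.
move=> hk; rewrite !inE; case: (boolP (boundary k)) => //= /existsP[i hi].
apply/andP; split; last by apply/forallP => l; apply/implyP => /hk.
have [<- //|im] := eqVneq i m.
by have := hk _ im; rewrite coord_interiorE hi.
Qed.

Lemma shift_up_interior (d N : nat) (m : 'I_d) (j : multi_index d N) :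
  j \in interior d N -> shift_up m j \in interior d N :|: open_face N m.
Proof.
rewrite !in_setC inE => /not_boundaryP hj.
by apply: off_boundary_or_open_face => i /negbTE im; rewrite ffunE im.
Qed.

Lemma shift_down_interior (d N : nat) (m : 'I_d) (j : multi_index d N) :
  j \in interior d N -> shift_down m j \in interior d N :|: open_face N m.
Proof.
rewrite !in_setC inE => /not_boundaryP hj.
by apply: off_boundary_or_open_face => i /negbTE im; rewrite ffunE im.
Qed.

Lemma open_face_boundary (d N : nat) (m : 'I_d) :
  open_face N m \subset B_set d N.
Proof.
by apply/subsetP => j; rewrite !inE => /andP[hm _]; apply/existsP; exists m.
Qed.

Lemma open_face_disjoint (d N : nat) (m m' : 'I_d) :
  m != m' -> [disjoint open_face N m & open_face N m'].
Proof.
move=> mm'; rewrite -setI_eq0; apply/eqP/setP => j; rewrite !inE.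
apply/negbTE/negP => /andP[/andP[hm _] /andP[_ /forallP/(_ m)]].
by rewrite mm' coord_interiorE hm.
Qed.

(** * Summation by parts *)

Lemma ler_sum_subset (R : numDomainType) (T : finType) (A B : {set T})
    (F : T -> R) : (forall x, 0 <= F x) -> A \subset B ->
  \sum_(x in A) F x <= \sum_(x in B) F x.
Proof.
move=> F0 AB; rewrite [leRHS](big_setID A) /= (setIidPr AB) lerDl.
exact: sumr_ge0.
Qed.

Lemma ler_sum_reindex (R : numDomainType) (T : finType) (A B : {set T})
    (s : T -> T) (F : T -> R) :
    (forall x, 0 <= F x) -> {in A &, injective s} ->
    (forall x, x \in A -> s x \in B) ->
  \sum_(x in A) F (s x) <= \sum_(x in B) F x.
Proof.
move=> F0 sI sAB; rewrite -(big_imset F sI); apply: ler_sum_subset => //.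
by apply/subsetP => _ /imsetP[x xA ->]; exact: sAB.
Qed.

(** For each direction the two shifted sums are reindexed by their images; each
    is at most the interior sum plus the sum over the open face, and the two
    interior sums cancel against the middle term. The factor 2 comes from
    charging the whole [open_face] once for each of the two shifts. *)
Lemma sum_second_difference_le (R : numDomainType) (d N : nat)
    (Q : multi_index d N -> R) : (forall j, 0 <= Q j) ->
  \sum_(j in interior d N) \sum_(m < d)
     (Q (shift_up m j) - 2 * Q j + Q (shift_down m j))
  <= 2 * \sum_(j in B_set d N) Q j.
Proof.
move=> Q0; rewrite exchange_big /=.
apply: (@le_trans _ _ (2 * \sum_(m < d) \sum_(j in open_face N m) Q j)).
  rewrite mulr_sumr; apply: ler_sum => m _.
  rewrite big_split sumrB -mulr_sumr /=.
  have faceU : \sum_(j in interior d N :|: open_face N m) Q j =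
      \sum_(j in interior d N) Q j + \sum_(j in open_face N m) Q j.
    rewrite -bigU; first by apply: eq_bigl => j; rewrite !inE.
    rewrite /interior disjoint_sym disjoints_subset setCK.
    exact: open_face_boundary.
  have := ler_sum_reindex Q0 (@shift_up_inj d N m) (@shift_up_interior d N m).
  have := ler_sum_reindex Q0 (@shift_down_inj d N m)
    (@shift_down_interior d N m).
  rewrite faceU => hdown hup.
  rewrite addrAC lerBlDr -mulrDr [X in 2 * X]addrC mulr_natl mulr2n.
  exact: lerD.
rewrite ler_pM2l ?ltr0n // -partition_disjoint_bigcup; last first.
  exact: open_face_disjoint.
apply: ler_sum_subset => //; apply/bigcupsP => m _.
exact: open_face_boundary.
Qed.

(** The function w Delta_h w is dominated by half of the second difference of
    w^2, a form of the convexity of squaring; this reduces the claim to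
    [sum_second_difference_le]. *)
Lemma sum_mul_laplacian_le (R : realType) (d N : nat) (h : R)
    (w : multi_index d N -> R) :
  \sum_(j in interior d N) w j * laplacian_h h w j
    <= h ^- 2 * \sum_(j in B_set d N) w j ^+ 2.
Proof.
have h2 : 0 <= h ^- 2 by rewrite invr_ge0 sqr_ge0.
under eq_bigr do rewrite mulrCA.
rewrite -mulr_sumr ler_wpM2l //.
rewrite -(@ler_pM2l _ 2) ?ltr0n // mulr_sumr.
apply: le_trans (sum_second_difference_le (fun j => sqr_ge0 (w j))).
apply: ler_sum => j _; rewrite !mulr_sumr; apply: ler_sum => m _.
(* The gap is the sum of the squares of the two one-sided differences. *)
rewrite -subr_ge0.
have := addr_ge0 (sqr_ge0 (w (shift_up m j) - w j))
  (sqr_ge0 (w (shift_down m j) - w j)).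
by congr (_ <= _); ring.
Qed.

(** * The implicit operator *)

(** At an interior node where w is minimal, all second differences are
    nonnegative, so (1 + c) w >= kappa Delta_h w >= 0 there. *)
Lemma implicit_op_min_principle (R : realType) (d N : nat) (h kappa : R)
    (c w : multi_index d N -> R) : 0 <= kappa ->
    (forall j, ~~ boundary j -> 0 <= c j) ->
    (forall j, boundary j -> 0 <= w j) ->
    (forall j, ~~ boundary j -> 0 <= implicit_op h (c j) kappa w j) ->
  forall j, 0 <= w j.
Proof.
move=> k0 c0 wB wI j0.
case: (arg_minP w (erefl : predT j0)) => /= j _ jmin.
apply: le_trans (jmin _ isT).
have [/wB //|jI] := boolP (boundary j).
have L0 : 0 <= kappa * laplacian_h h w j.
  rewrite mulr_ge0 // mulr_ge0 ?invr_ge0 ?sqr_ge0 //.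
  apply: sumr_ge0 => m _.
  have := jmin (shift_up m j) isT; have := jmin (shift_down m j) isT; lra.
have := wI _ jI; rewrite /implicit_op subr_ge0 => /(le_trans L0).
by rewrite pmulr_rge0 // ltr_pwDl // c0.
Qed.

(** The nodes entering the norm, those off the faces j_i = 0, are the interior
    nodes together with B_N. *)
Lemma norm2_hB (R : realType) (d N : nat) (h : R)
    (w f : multi_index d N -> R) : (0 < N)%N -> 0 <= h ->
  norm2_h h w ^+ 2 - norm2_h h f ^+ 2 =
  h * \sum_(j in BN_set d N) (w j ^+ 2 - f j ^+ 2) +
  h * \sum_(j in interior d N) (w j ^+ 2 - f j ^+ 2).
Proof.
move=> N0 h0.
rewrite /norm2_h !sqr_sqrtr; try by apply: sumr_ge0 => j _;
  rewrite mulr_ge0 ?sqr_ge0.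
rewrite -sumrB.
under eq_bigr do rewrite -mulrBr.
rewrite -mulr_sumr -mulrDr (bigID (mem (BN_set d N))) /=.
congr (_ * (_ + _)); apply: eq_bigl => j; rewrite !inE.
  by rewrite andbA andbb.
rewrite /boundary negb_exists.
case: (boolP [forall i, _]) => /= [/forallP j0|].
  rewrite negb_exists; apply: eq_forallb => i; by rewrite (negbTE (j0 i)).
rewrite negb_forall => /existsP[i]; rewrite negbK => ji.
by apply/esym/negbTE; rewrite negb_forall; apply/existsP; exists i; rewrite ji.
Qed.

(** One backward Euler step for diffusion with a nonnegative reaction
    coefficient dissipates the energy up to boundary terms: w^2 - f^2 is at most
    2 w (w - f), in which the reaction part of w - f only helps. *)
Lemma implicit_step_energy (R : realType) (d N : nat) (h kappa : R)
    (c w f : multi_index d N -> R) : (0 < N)%N -> 0 < h -> 0 <= kappa ->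
    (forall j, ~~ boundary j -> 0 <= c j) ->
    (forall j, ~~ boundary j -> implicit_op h (c j) kappa w j = f j) ->
  norm2_h h w ^+ 2 - norm2_h h f ^+ 2 <=
  h * \sum_(j in BN_set d N) (w j ^+ 2 - f j ^+ 2) +
  2 * (kappa / h) * \sum_(j in B_set d N) w j ^+ 2.
Proof.
move=> N0 h0 k0 c0 hw; rewrite (norm2_hB _ _ N0 (ltW h0)) lerD2l.
have -> : 2 * (kappa / h) * \sum_(j in B_set d N) w j ^+ 2 =
    h * (2 * kappa * (h ^- 2 * \sum_(j in B_set d N) w j ^+ 2)).
  by field; exact: lt0r_neq0.
rewrite ler_pM2l //.
have k2 : 0 <= 2 * kappa by rewrite mulr_ge0.
apply: le_trans (ler_wpM2l k2 (sum_mul_laplacian_le h w)).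
rewrite mulr_sumr; apply: ler_sum => j; rewrite !inE => jI.
have := c0 _ jI; have := hw _ jI; rewrite /implicit_op => <- cj.
(* This is the square (w - f)^2, with f expressed through w. *)
have := sqr_ge0 (c j * w j - kappa * laplacian_h h w j).
have := mulr_ge0 cj (sqr_ge0 (w j)).
set L := laplacian_h _ _ _; nra.
Qed.

(** * A priori bounds for the scheme *)

(** With t = tau / eps, the new value is the weighted mean of p, 1 and 0 with
    weights 1, t u and t v. *)
Lemma scheme_p_unit_interval (R : realFieldType) (u v p p' t : R) :
    0 <= t -> 0 <= u -> 0 <= v -> 0 <= p <= 1 ->
    (1 + t * (u + v)) * p' = p + t * u ->
  0 <= p' <= 1.
Proof.
move=> t0 u0 v0 /andP[p0 p1] e.
have tu : 0 <= t * u by exact: mulr_ge0.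
have tv : 0 <= t * v by exact: mulr_ge0.
have D0 : 0 < 1 + t * (u + v) by lra.
by rewrite -(pmulr_rge0 p' D0) -(ler_pM2l D0 p') e; apply/andP; split; lra.
Qed.

(** The scheme decouples within a time step: the bounds at level n give those on
    the new p, these give a nonnegative coefficient in the equation for the new
    u, and both together one in the equation for the new v. *)
Lemma scheme_bounds (R : realType) (d N : nat)
    (a b eps lambda d1 d2 tau : R) (u_bd v_bd : R -> R)
    (u v p : nat -> multi_index d N -> R) :
    0 < eps -> 0 < lambda -> 0 < d1 -> 0 < d2 -> 0 < tau ->
    (forall j, 0 <= u 0%N j) -> (forall j, 0 <= v 0%N j) ->
    (forall j, 0 <= p 0%N j <= 1) ->
    (forall n : nat, (0 < n)%N -> 0 <= u_bd (n%:R * tau)) ->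
    (forall n : nat, (0 < n)%N -> 0 <= v_bd (n%:R * tau)) ->
    scheme_solution a b eps lambda d1 d2 tau u_bd v_bd u v p ->
  forall n, [/\ forall j, 0 <= u n j, forall j, 0 <= v n j
              & forall j, 0 <= p n j <= 1].
Proof.
move=> eps0 lambda0 d10 d20 tau0 u0 v0 p0 u_bd0 v_bd0 [Hp Hu Hv Du Dv].
have t0 : 0 <= tau / eps by rewrite divr_ge0 // ltW.
elim=> [|n [un vn pn]]; first by split.
have pS j : 0 <= p n.+1 j <= 1.
  exact: scheme_p_unit_interval t0 (un j) (vn j) (pn j) (Hp n j).
have uS : forall j, 0 <= u n.+1 j.
  apply: (@implicit_op_min_principle _ _ _ (mesh_size a b N) (d1 * tau)
    (fun j => tau / eps * (v n j + lambda * (1 - p n.+1 j)))).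
  - by rewrite mulr_ge0 ?ltW.
  - move=> j _; have /andP[_ p1] := pS j.
    by rewrite mulr_ge0 // addr_ge0 // mulr_ge0 ?subr_ge0 // ltW.
  - by move=> j jB; rewrite Du ?u_bd0.
  - by move=> j jI; rewrite Hu.
split=> //.
apply: (@implicit_op_min_principle _ _ _ (mesh_size a b N) (d2 * tau)
  (fun j => tau / eps * (u n.+1 j + lambda * p n.+1 j))).
- by rewrite mulr_ge0 ?ltW.
- move=> j _; have /andP[p0' _] := pS j.
  by rewrite mulr_ge0 // addr_ge0 // mulr_ge0 // ltW.
- by move=> j jB; rewrite Dv ?v_bd0.
- by move=> j jI; rewrite Hv.
Qed.

Theorem theorem2p2 (R : realType) (d N : nat)
    (a b eps lambda d1 d2 tau : R) (u_bd v_bd : R -> R)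
    (u v p : nat -> multi_index d N -> R)
    (hN : (0 < N)%N) (hab : a < b)
    (heps : 0 < eps) (hlambda : 0 < lambda) (hd1 : 0 < d1) (hd2 : 0 < d2)
    (htau : 0 < tau)
    (hu0 : forall j, 0 <= u 0%N j) (hv0 : forall j, 0 <= v 0%N j)
    (hp0 : forall j, 0 <= p 0%N j <= 1)
    (hu_bd : forall n : nat, (0 < n)%N -> 0 <= u_bd (n%:R * tau))
    (hv_bd : forall n : nat, (0 < n)%N -> 0 <= v_bd (n%:R * tau))
    (hsol : scheme_solution a b eps lambda d1 d2 tau u_bd v_bd u v p) :
  let h := mesh_size a b N in
  forall n : nat,
    norm2_h h (u n.+1) ^+ 2 - norm2_h h (u n) ^+ 2
      <= h * \sum_(j in BN_set d N) (u n.+1 j ^+ 2 - u n j ^+ 2)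
         + 2 * d1 * (tau / h) * \sum_(j in B_set d N) u n.+1 j ^+ 2
    /\
    norm2_h h (v n.+1) ^+ 2 - norm2_h h (v n) ^+ 2
      <= h * \sum_(j in BN_set d N) (v n.+1 j ^+ 2 - v n j ^+ 2)
         + 2 * d2 * (tau / h) * \sum_(j in B_set d N) v n.+1 j ^+ 2.
Proof.
move=> h n.
have h0 : 0 < h by rewrite divr_gt0 ?subr_gt0 ?ltr0n.
have bounds := scheme_bounds heps hlambda hd1 hd2 htau hu0 hv0 hp0 hu_bd hv_bd
  hsol.
have [_ vn _] := bounds n; have [uS _ pS] := bounds n.+1.
have t0 : 0 <= tau / eps by rewrite divr_ge0 // ltW.
have assoc (x : R) : 2 * x * (tau / h) = 2 * (x * tau / h) by rewrite -!mulrA.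
rewrite !assoc; split.
  apply: implicit_step_energy (scheme_u hsol n) => //.
    by rewrite mulr_ge0 ?ltW.
  move=> j _; have /andP[_ p1] := pS j.
  by rewrite mulr_ge0 // addr_ge0 // mulr_ge0 ?subr_ge0 // ltW.
apply: implicit_step_energy (scheme_v hsol n) => //.
  by rewrite mulr_ge0 ?ltW.
move=> j _; have /andP[p0 _] := pS j.
by rewrite mulr_ge0 // addr_ge0 // mulr_ge0 // ltW.
Qed.
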